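(* Let $t \geq 128$ be a rational integer. Put \[ \epsilon = \frac{t+\sqrt{t^{2}+16}}{4}, \quad \rho = \sqrt{1+\epsilon^{2}}, \] \[ \beta^{(0)} = \epsilon-\rho, \quad \beta^{(1)} = \frac{\rho-1}{\epsilon}, \quad \beta^{(2)} = \rho+\epsilon, \quad \beta^{(3)} = -\frac{\rho+1}{\epsilon} \] (these are the four roots of $X^{4}-tX^{3}-6X^{2}+tX+1$), and define \[ \kappa = \frac{\log (8\epsilon)}{\log (\epsilon/8)}. \] Then for $j=0,1,2,3$ and any rational integers $p$ and $q$ with $|q| > 0.16t$, we have \[ \left| p - \beta^{(j)} q \right| > \frac{1}{c_{j}|q|^{\kappa}}, \] where $c_{0} = c_{1} = c_{3} = 11.33\,t \cdot 0.4^{\kappa}$ and $c_{2} = 8.01\,t\,(0.4t)^{\kappa}$. *)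

(* Defs.v *)
From Stdlib Require Import Reals ZArith.
Open Scope R_scope.

Definition eps_t (t : Z) : R := (IZR t + sqrt (IZR t ^ 2 + 16)) / 4.
Definition rho_t (t : Z) : R := sqrt (1 + eps_t t ^ 2).

Definition beta_t (t : Z) (j : nat) : R :=
  match j with
  | 0%nat => eps_t t - rho_t t
  | 1%nat => (rho_t t - 1) / eps_t t
  | 2%nat => rho_t t + eps_t t
  | _ => - ((rho_t t + 1) / eps_t t)
  end.

Definition kappa_t (t : Z) : R := ln (8 * eps_t t) / ln (eps_t t / 8).

Definition c_t (t : Z) (j : nat) : R :=
  match j with
  | 2%nat => (801/100) * IZR t * Rpower ((4/10) * IZR t) (kappa_t t)
  | _ => (1133/100) * IZR t * Rpower (4/10) (kappa_t t)
  end.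

(* Main.v *)
Require Import Defs.
From Stdlib Require Import Reals ZArith Lra Lia.
From Coquelicot Require Import Coquelicot.
Open Scope R_scope.

(** With [phi = atan (4 / t)] one has [beta_2 = cot (phi / 4)], which is the value of
    the continued fraction [t + 15/(3t + 63/(5t + 143/(7t + ...)))] with partial
    numerators [16 n^2 - 1].  Its suitably normalised convergents [a n / b n] are the
    diagonal Pade approximants of the fourth root of [(t - 4i) / (t + 4i)], and this
    makes [a n] and [b n] integers.  The remainder [b n * beta_2 - a n] is, up to an
    explicit factor of sign [(-1)^(n+1)], the integral of
    [(cos s - cos phi)^n cos (s / 4)] over [0, phi], so it alternates.  Since the
    recurrence has characteristic roots [8 eps] and [- 8 / eps], positivity bounds
    [a n], [b n] above by [(8 eps)^n] and [b n] below, and then the Casoratian bounds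
    the remainder by [(8 / eps)^n].  The roots [beta_0, beta_1, beta_3] are images of
    [beta_2] under integral Moebius maps of determinant 1 or 2, which turn
    [(a, b)] into [(- b, a)], [(a - b, a + b)] and [(- (a + b), a - b)].  The usual
    comparison of [p / q] with one of two consecutive approximants concludes. *)

(** * Integrality *)

Fixpoint falling (x : Z) (k : nat) : Z :=
  match k with
  | O => 1
  | S i => falling x i * (x - Z.of_nat i)
  end%Z.

(** Pascal's rule multiplied by [(k + 1)!]; it drives the inner induction on [n] in
    [fact_divide_falling]. *)
Lemma falling_succ (x : Z) (k : nat) :
  (falling (x + 1) (S k) = falling x (S k) + Z.of_nat (S k) * falling x k)%Z.
Proof.
  induction k as [|k IH]; [unfold falling; simpl Z.of_nat; ring|].
  change (falling (x + 1) (S (S k))) with (falling (x + 1) (S k) * (x + 1 - Z.of_nat (S k)))%Z.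
  rewrite IH.
  change (falling x (S (S k))) with (falling x (S k) * (x - Z.of_nat (S k)))%Z.
  change (falling x (S k)) with (falling x k * (x - Z.of_nat k))%Z.
  rewrite !Nat2Z.inj_succ; unfold Z.succ; ring.
Qed.

Lemma fact_divide_falling (n k : nat) :
  (Z.of_nat (fact k) | falling (Z.of_nat n) k)%Z.
Proof.
  revert n; induction k as [|k IHk]; intros n; [apply Z.divide_1_l|].
  induction n as [|n IHn].
  - replace (falling (Z.of_nat 0) (S k)) with 0%Z; [apply Z.divide_0_r|].
    clear; induction k as [|k IH]; [reflexivity|].
    change (0 = falling (Z.of_nat 0) (S k) * (Z.of_nat 0 - Z.of_nat (S k)))%Z.
    rewrite <- IH; reflexivity.
  - rewrite Nat2Z.inj_succ; unfold Z.succ; rewrite falling_succ.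
    apply Z.divide_add_r; [exact IHn|].
    change (fact (S k)) with (S k * fact k)%nat; rewrite Nat2Z.inj_mul.
    apply Z.mul_divide_mono_l, IHk.
Qed.

(** The even factors of [(2n)!] give [2^n n!] and the others have odd product, so strong induction
    that halves [k] collects at most [n + n] factors 2. *)
Lemma fact_divide_pow2_odd (k : nat) :
  exists h : nat, (Z.of_nat (fact k) | 2 ^ Z.of_nat k * (2 * Z.of_nat h + 1))%Z.
Proof.
  assert (even_fact : forall n, exists h, (Z.of_nat (fact (2 * n)) =
    2 ^ Z.of_nat n * Z.of_nat (fact n) * (2 * Z.of_nat h + 1))%Z).
  { induction n as [|n [h IH]]; [exists 0%nat; reflexivity|].
    exists (2 * n * h + h + n)%nat.
    replace (2 * S n)%nat with (S (S (2 * n))) by lia.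
    change (fact (S (S (2 * n)))) with (S (S (2 * n)) * (S (2 * n) * fact (2 * n)))%nat.
    change (fact (S n)) with (S n * fact n)%nat.
    rewrite !Nat2Z.inj_mul, IH, !Nat2Z.inj_succ, Z.pow_succ_r by lia.
    rewrite !Nat2Z.inj_add, !Nat2Z.inj_mul; unfold Z.succ; simpl (Z.of_nat 2); ring. }
  induction k as [k IH] using (well_founded_induction lt_wf).
  destruct (Nat.Even_or_Odd k) as [[n Hn]|[n Hn]].
  - destruct (Nat.eq_dec n 0) as [->|n0].
    { subst k; exists 0%nat; apply Z.divide_1_l. }
    destruct (IH n ltac:(lia)) as [h [x Hx]], (even_fact n) as [g Hg].
    subst k; exists (2 * h * g + h + g)%nat; exists x.
    rewrite Hg; replace (Z.of_nat (2 * n)) with (Z.of_nat n + Z.of_nat n)%Z by lia.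
    rewrite Z.pow_add_r by lia.
    rewrite !Nat2Z.inj_add, !Nat2Z.inj_mul; simpl (Z.of_nat 2).
    transitivity (2 ^ Z.of_nat n * (2 ^ Z.of_nat n * (2 * Z.of_nat h + 1)) *
      (2 * Z.of_nat g + 1))%Z; [ring|rewrite Hx; ring].
  - destruct (Nat.eq_dec n 0) as [->|n0].
    { subst k; exists 0%nat; apply Z.divide_1_l. }
    destruct (IH (2 * n)%nat ltac:(lia)) as [h [x Hx]].
    subst k; exists (2 * n * h + h + n)%nat; exists (2 * x)%Z.
    replace (2 * n + 1)%nat with (S (2 * n)) by lia.
    change (fact (S (2 * n))) with (S (2 * n) * fact (2 * n))%nat.
    rewrite Nat2Z.inj_mul, !(Nat2Z.inj_succ (2 * n)), Z.pow_succ_r by lia.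
    transitivity (2 * (2 ^ Z.of_nat (2 * n) * (2 * Z.of_nat h + 1)) * (2 * Z.of_nat n + 1))%Z;
      [rewrite !Nat2Z.inj_add, !Nat2Z.inj_mul; simpl (Z.of_nat 2); ring|].
    rewrite Hx; rewrite Nat2Z.inj_mul; simpl (Z.of_nat 2); unfold Z.succ; ring.
Qed.

(** This is [4^k] times the falling factorial of [x - 1/4]. *)
Fixpoint quarter_falling (x : Z) (k : nat) : Z :=
  match k with
  | O => 1
  | S i => quarter_falling x i * (4 * (x - Z.of_nat i) - 1)
  end%Z.

(* Modulo an odd [m], [-1/4] is congruent to a natural number, so that
   [quarter_falling x k] is congruent to [4^k] times a falling factorial. *)
Lemma fact_divide_quarter_falling (n k : nat) :
  (Z.of_nat (fact k) | 2 ^ Z.of_nat k * quarter_falling (Z.of_nat n) k)%Z.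
Proof.
  destruct (fact_divide_pow2_odd k) as [h [x Hx]].
  (* Here [4 s = (2h)^3], and [8h^3 + 1 = (2h + 1)(4h^2 - 2h + 1)], so [s] represents [-1/4] modulo
     [2h + 1]. *)
  set (s := (2 * h * (h * h))%nat).
  assert (Hs : (4 * Z.of_nat s = - 1 +
    (2 * Z.of_nat h + 1) * (4 * Z.of_nat h * Z.of_nat h - 2 * Z.of_nat h + 1))%Z).
  { unfold s; rewrite !Nat2Z.inj_mul; simpl (Z.of_nat 2); ring. }
  assert (cong : forall i, exists y, (quarter_falling (Z.of_nat n) i =
    4 ^ Z.of_nat i * falling (Z.of_nat (n + s)) i + (2 * Z.of_nat h + 1) * y)%Z).
  { induction i as [|i [y IH]]; [exists 0%Z; simpl falling; simpl quarter_falling; change (4 ^ Z.of_nat 0)%Z with 1%Z; ring|].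
    exists (y * (4 * (Z.of_nat n - Z.of_nat i) - 1) - 4 ^ Z.of_nat i *
      falling (Z.of_nat (n + s)) i * (4 * Z.of_nat h * Z.of_nat h - 2 * Z.of_nat h + 1))%Z.
    change (quarter_falling (Z.of_nat n) (S i)) with
      (quarter_falling (Z.of_nat n) i * (4 * (Z.of_nat n - Z.of_nat i) - 1))%Z; simpl falling.
    rewrite IH, (Nat2Z.inj_succ i), Z.pow_succ_r, Nat2Z.inj_add by lia.
    set (c := falling _ _).
    replace (4 * 4 ^ Z.of_nat i * (c * (Z.of_nat n + Z.of_nat s - Z.of_nat i)))%Z
      with (4 ^ Z.of_nat i * c * (4 * (Z.of_nat n - Z.of_nat i) + 4 * Z.of_nat s))%Z by ring.
    rewrite Hs; ring. }
  destruct (cong k) as [y Hy], (fact_divide_falling (n + s) k) as [w Hw].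
  exists (2 ^ Z.of_nat k * 4 ^ Z.of_nat k * w + x * y)%Z.
  rewrite Hy, Hw.
  transitivity (2 ^ Z.of_nat k * 4 ^ Z.of_nat k * w * Z.of_nat (fact k) +
    (2 ^ Z.of_nat k * (2 * Z.of_nat h + 1)) * y)%Z; [ring|rewrite Hx; ring].
Qed.

(** * Integrality of generalised binomial coefficients *)

Definition is_int (x : R) : Prop := exists z : Z, x = IZR z.

Lemma is_int_IZR (z : Z) : is_int (IZR z).
Proof. now exists z. Qed.

Lemma is_int_plus (x y : R) : is_int x -> is_int y -> is_int (x + y).
Proof. intros [m ->] [n ->]; exists (m + n)%Z; now rewrite plus_IZR. Qed.

Lemma is_int_minus (x y : R) : is_int x -> is_int y -> is_int (x - y).
Proof. intros [m ->] [n ->]; exists (m - n)%Z; now rewrite minus_IZR. Qed.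

Lemma is_int_mult (x y : R) : is_int x -> is_int y -> is_int (x * y).
Proof. intros [m ->] [n ->]; exists (m * n)%Z; now rewrite mult_IZR. Qed.

(** The binomial coefficient [x] over [k] for real [x]. *)
Fixpoint gbin (x : R) (k : nat) : R :=
  match k with
  | O => 1
  | S i => gbin x i * (x - INR i) / INR (S i)
  end.

Lemma gbin_S (x : R) (k : nat) : gbin x (S k) = gbin x k * (x - INR k) / INR (S k).
Proof. reflexivity. Qed.

Lemma gbin_succ (x : R) (k : nat) :
  gbin (x + 1) (S k) = gbin x k * (x + 1) / INR (S k).
Proof.
  induction k as [|k IH]; [simpl; field|].
  rewrite (gbin_S (x + 1)), IH, (gbin_S x).
  rewrite !S_INR; pose proof (pos_INR k); field; lra.
Qed.

Lemma gbin_falling (n k : nat) :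
  INR (fact k) * gbin (INR n) k = IZR (falling (Z.of_nat n) k).
Proof.
  induction k as [|k IH]; [simpl; ring|].
  change (fact (S k)) with (S k * fact k)%nat; rewrite mult_INR.
  simpl falling; rewrite gbin_S; rewrite mult_IZR, <- IH, minus_IZR, <- !INR_IZR_INZ.
  field; apply not_0_INR; lia.
Qed.

Lemma gbin_quarter_falling (n k : nat) :
  INR (fact k) * (8 ^ k * gbin (INR n - 1 / 4) k) =
  IZR (2 ^ Z.of_nat k * quarter_falling (Z.of_nat n) k).
Proof.
  induction k as [|k IH]; [simpl; ring|].
  change (fact (S k)) with (S k * fact k)%nat; rewrite mult_INR.
  rewrite Nat2Z.inj_succ, Z.pow_succ_r by lia.
  change (quarter_falling (Z.of_nat n) (S k)) with
      (quarter_falling (Z.of_nat n) k * (4 * (Z.of_nat n - Z.of_nat k) - 1))%Z; rewrite gbin_S.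
  replace (2 * 2 ^ Z.of_nat k * (quarter_falling (Z.of_nat n) k * (4 * (Z.of_nat n - Z.of_nat k) - 1)))%Z
    with (2 ^ Z.of_nat k * quarter_falling (Z.of_nat n) k * (8 * (Z.of_nat n - Z.of_nat k) - 2))%Z by ring.
  rewrite mult_IZR, <- IH, minus_IZR, mult_IZR, minus_IZR, <- !INR_IZR_INZ.
  simpl pow; field; apply not_0_INR; lia.
Qed.

Lemma is_int_div_fact (k : nat) (x : R) (z : Z) :
  INR (fact k) * x = IZR z -> (Z.of_nat (fact k) | z)%Z -> is_int x.
Proof.
  intros Hx [w ->]; exists w.
  rewrite mult_IZR, <- INR_IZR_INZ in Hx.
  apply (Rmult_eq_reg_l (INR (fact k))); [lra|apply INR_fact_neq_0].
Qed.

Lemma is_int_gbin (n k : nat) : is_int (gbin (INR n) k).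
Proof. exact (is_int_div_fact _ _ _ (gbin_falling n k) (fact_divide_falling n k)). Qed.

(** In each factor 8, a 4 clears the quarter and a 2 pays for the powers of 2 in [k!]. *)
Lemma is_int_gbin_quarter (n k : nat) : is_int (8 ^ k * gbin (INR n - 1 / 4) k).
Proof.
  exact (is_int_div_fact _ _ _ (gbin_quarter_falling n k) (fact_divide_quarter_falling n k)).
Qed.

(** * Coefficients and recurrence of the Pade denominators *)

(* [C(r - 1/4, r - j) * C(r + j, j)], in a form that also vanishes for [j > r]. *)
Fixpoint pade_coef (r j : nat) : R :=
  match j with
  | O => gbin (INR r - 1 / 4) r
  | S i => pade_coef r i *
      ((INR r - INR i) * (INR r + INR i + 1) / ((INR i + 1) * (INR i + 3 / 4)))
  end.

(** The recursive form serves the contiguity relations; this product form serves integrality. *)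
Lemma pade_coef_gbin (r j : nat) : (j <= r)%nat ->
  pade_coef r j = gbin (INR r - 1 / 4) (r - j) * gbin (INR (r + j)) j.
Proof.
  induction j as [|j IH]; intros Hj.
  - rewrite Nat.sub_0_r; simpl; ring.
  - simpl pade_coef; rewrite IH by lia.
    replace (r - j)%nat with (S (r - S j)) by lia.
    replace (INR (r + S j)) with (INR (r + j) + 1) by (rewrite !plus_INR, S_INR; ring).
    rewrite gbin_succ, (gbin_S (INR r - 1 / 4)).
    rewrite S_INR, minus_INR, plus_INR, !S_INR by lia.
    assert (INR j + 1 <= INR r) by (rewrite <- S_INR; apply le_INR; lia).
    pose proof (pos_INR j); field; lra.
Qed.

Lemma pade_coef_out (r j : nat) : (r < j)%nat -> pade_coef r j = 0.
Proof.
  induction j as [|j IH]; intros Hj; [lia|].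
  simpl; destruct (Nat.eq_dec r j) as [->|]; [|rewrite IH by lia; ring].
  unfold Rdiv; ring.
Qed.

Lemma gbin_diag_succ (r : nat) :
  gbin (INR (S r) - 1 / 4) (S r) = gbin (INR r - 1 / 4) r * (INR r + 3 / 4) / (INR r + 1).
Proof.
  replace (INR (S r) - 1 / 4) with (INR r - 1 / 4 + 1) by (rewrite S_INR; ring).
  rewrite gbin_succ, S_INR; f_equal; f_equal; field.
Qed.

Lemma pade_coef_S (r i : nat) : pade_coef r (S i) = pade_coef r i *
  ((INR r - INR i) * (INR r + INR i + 1) / ((INR i + 1) * (INR i + 3 / 4))).
Proof. reflexivity. Qed.

(** With [pade_coef_pred_succ], this writes the coefficients of two neighbouring degrees at [i + 1]
    as rational multiples of one coefficient at [i], so that the three-term recurrence becomes a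
    field identity. *)
Lemma pade_coef_succ_succ (r i : nat) :
  pade_coef (S r) (S i) = pade_coef r i * ((INR r + 3 / 4) / (INR r + 1)) *
    ((INR r + INR i + 1) * (INR r + INR i + 2) / ((INR i + 1) * (INR i + 3 / 4))).
Proof.
  pose proof (pos_INR r).
  induction i as [|i IH].
  - rewrite pade_coef_S; unfold pade_coef at 1 2.
    rewrite gbin_diag_succ, S_INR; simpl (INR 0); field; lra.
  - rewrite (pade_coef_S (S r)), IH, (pade_coef_S r), !S_INR.
    pose proof (pos_INR i); field; lra.
Qed.

Lemma pade_coef_pred_succ (r i : nat) :
  pade_coef r (S i) = pade_coef (S r) i * ((INR r + 1) / (INR r + 3 / 4)) *
    ((INR r - INR i) * (INR r + 1 - INR i) / ((INR i + 1) * (INR i + 3 / 4))).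
Proof.
  pose proof (pos_INR r).
  induction i as [|i IH].
  - rewrite pade_coef_S; unfold pade_coef at 1 2.
    rewrite gbin_diag_succ; simpl (INR 0); field; lra.
  - rewrite (pade_coef_S r (S i)), IH, (pade_coef_S (S r)), !S_INR.
    pose proof (pos_INR i); field; lra.
Qed.

Lemma pade_coef_rec_0 (r : nat) :
  (INR r + 2) * pade_coef (S (S r)) 0 =
  (2 * INR r + 3) * pade_coef (S r) 0 -
  ((INR r + 1) - 1 / (16 * (INR r + 1))) * pade_coef r 0.
Proof.
  unfold pade_coef; rewrite !gbin_diag_succ, !S_INR.
  pose proof (pos_INR r); field; lra.
Qed.

Lemma pade_coef_rec_S (r i : nat) :
  (INR r + 2) * pade_coef (S (S r)) (S i) =
  (2 * INR r + 3) * (2 * pade_coef (S r) i + pade_coef (S r) (S i)) -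
  ((INR r + 1) - 1 / (16 * (INR r + 1))) * pade_coef r (S i).
Proof.
  rewrite (pade_coef_succ_succ (S r)), (pade_coef_pred_succ r), (pade_coef_S (S r)), !S_INR.
  pose proof (pos_INR r); pose proof (pos_INR i); field; lra.
Qed.

(** The number [n] of terms is kept apart from the degree [r], so that identities follow by
    induction on [n]. *)
Fixpoint pade_sum (r : nat) (x : C) (n : nat) : C :=
  match n with
  | O => RtoC 0
  | S j => pade_sum r x j + pade_coef r j * x ^ j
  end%C.

Lemma pade_sum_S (r : nat) (x : C) (j : nat) :
  pade_sum r x (S j) = (pade_sum r x j + pade_coef r j * x ^ j)%C.
Proof. reflexivity. Qed.

(** The factor [2 * x] shifts indices by one, hence its sum has [n] terms where the others have
    [n + 1]. *)
Lemma pade_sum_rec (r : nat) (x : C) (n : nat) :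
  (RtoC (INR r + 2) * pade_sum (S (S r)) x (S n) =
   RtoC (2 * INR r + 3) * (2 * x * pade_sum (S r) x n + pade_sum (S r) x (S n)) -
   RtoC ((INR r + 1) - 1 / (16 * (INR r + 1))) * pade_sum r x (S n))%C.
Proof.
  induction n as [|n IH].
  - pose proof (f_equal RtoC (pade_coef_rec_0 r)) as H.
    rewrite RtoC_minus, !RtoC_mult in H.
    rewrite !pade_sum_S; simpl pade_sum; simpl (x ^ 0)%C.
    transitivity (RtoC (INR r + 2) * RtoC (pade_coef (S (S r)) 0))%C; [ring|].
    rewrite H; ring.
  - pose proof (f_equal RtoC (pade_coef_rec_S r n)) as H.
    rewrite RtoC_minus, !RtoC_mult, (RtoC_plus (2 * pade_coef _ _)), (RtoC_mult 2) in H.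
    rewrite (pade_sum_S (S (S r))), (pade_sum_S (S r) x (S n)), (pade_sum_S r x (S n)).
    rewrite Cmult_plus_distr_l, IH, (pade_sum_S (S r) x n).
    rewrite Cmult_assoc, H; simpl (x ^ S n)%C; ring.
Qed.

Lemma pade_sum_stable (r : nat) (x : C) (n : nat) : (S r <= n)%nat ->
  pade_sum r x n = pade_sum r x (S r).
Proof.
  intros Hn; induction Hn as [|n Hn IH]; [reflexivity|].
  rewrite pade_sum_S, IH, (pade_coef_out r n) by lia; ring.
Qed.

(* [y n = 2^n / n! * p n] where [p (n+1) = (2n+1) t * p n + (16 n^2 - 1) * p (n-1)]. *)
Definition thue_rec (t : R) (y : nat -> R) : Prop := forall n,
  (INR n + 2) * y (S (S n)) =
  (2 * INR n + 3) * (2 * t) * y (S n) + (64 * (INR n + 1) - 4 / (INR n + 1)) * y n.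

Definition is_gauss (x : C) : Prop := is_int (fst x) /\ is_int (snd x).

Lemma is_gauss_plus (x y : C) : is_gauss x -> is_gauss y -> is_gauss (x + y)%C.
Proof. intros [Hx Hx'] [Hy Hy']; split; apply is_int_plus; assumption. Qed.

Lemma is_gauss_mult (x y : C) : is_gauss x -> is_gauss y -> is_gauss (x * y)%C.
Proof.
  intros [Hx Hx'] [Hy Hy']; split; simpl.
  - apply is_int_minus; apply is_int_mult; assumption.
  - apply is_int_plus; apply is_int_mult; assumption.
Qed.

Lemma is_gauss_RtoC (x : R) : is_int x -> is_gauss (RtoC x).
Proof. intros Hx; split; [exact Hx|apply (is_int_IZR 0)]. Qed.

Lemma is_gauss_pow (x : C) (n : nat) : is_gauss x -> is_gauss (x ^ n)%C.
Proof.
  intros Hx; induction n as [|n IH].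
  - apply (is_gauss_RtoC 1), (is_int_IZR 1).
  - simpl; apply is_gauss_mult; assumption.
Qed.

(* Here [x] is [u / z] for [u = t + 4i] and [z = - 8i], so that [z ^ r * pade_sum r x]
   is the homogeneous form of the diagonal Pade denominator of
   [(1 + z / u) ^ (1/4)], and [1 + z / u] is the conjugate of [u] divided by [u]. *)
Lemma thue_rec_int_solutions (t : Z) : exists a b : nat -> R,
  thue_rec (IZR t) a /\ thue_rec (IZR t) b /\
  a 0%nat = 1 /\ a 1%nat = 2 * IZR t /\ b 0%nat = 0 /\ b 1%nat = 2 /\
  (forall n, is_int (a n)) /\ (forall n, is_int (b n)).
Proof.
  set (x := (- 1 / 2, IZR t / 8) : C).
  set (z := (0, - 8) : C).
  set (w := fun r => (z ^ r * pade_sum r x (S r))%C).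
  assert (Hw : forall r, (RtoC (INR r + 2) * w (S (S r)) =
    RtoC ((2 * INR r + 3) * (2 * IZR t)) * w (S r) +
    RtoC (64 * (INR r + 1) - 4 / (INR r + 1)) * w r)%C).
  { intros r; unfold w.
    pose proof (pade_sum_rec r x (S (S r))) as H.
    rewrite (pade_sum_stable (S r) x (S (S (S r)))) in H by lia.
    rewrite (pade_sum_stable r x (S (S (S r)))) in H by lia.
    (* After multiplication by [z ^ (r + 2)], these two identities make all coefficients of the
       recurrence real. *)
    assert (Hz : (z * (2 * x + 1) = RtoC (2 * IZR t))%C).
    { unfold x, z; apply injective_projections; simpl; field. }
    assert (Hz2 : (z * z = RtoC (- 64))%C).
    { unfold z; apply injective_projections; simpl; ring. }
    replace (64 * (INR r + 1) - 4 / (INR r + 1)) with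
      (- 64 * - ((INR r + 1) - 1 / (16 * (INR r + 1))))
      by (pose proof (pos_INR r); field; lra).
    rewrite (RtoC_mult (- 64)), RtoC_opp, (RtoC_mult (2 * INR r + 3)), <- Hz, <- Hz2.
    simpl (z ^ S (S r))%C; simpl (z ^ S r)%C.
    transitivity (z * (z * z ^ r) * (RtoC (INR r + 2) * pade_sum (S (S r)) x (S (S (S r)))))%C;
      [ring|rewrite H; ring]. }
  assert (Hg : forall r, is_gauss (w r)).
  { intros r; unfold w.
    assert (H : forall n, (n <= S r)%nat -> is_gauss (z ^ r * pade_sum r x n)%C).
    2: { apply H; lia. }
    induction n as [|n IH]; intros Hn.
    - simpl pade_sum; replace (z ^ r * 0)%C with (RtoC 0) by ring.
      apply is_gauss_RtoC, (is_int_IZR 0).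
    - rewrite pade_sum_S, Cmult_plus_distr_l; apply is_gauss_plus; [apply IH; lia|].
      rewrite pade_coef_gbin by lia.
      (* The part [z ^ (r - n)] supplies the [8 ^ (r - n)] needed by the quarter binomial, and
         [z ^ n * x ^ n = (t + 4i)^n]. *)
      replace (z ^ r)%C with (z ^ (r - n + n))%C by (f_equal; lia).
      rewrite Cpow_add_r.
      assert (Hz : (forall m, z ^ m = RtoC (8 ^ m) * (0, - 1) ^ m)%C).
      { induction m as [|m IHm]; [simpl; ring|].
        simpl; rewrite IHm, RtoC_mult.
        replace z with (RtoC 8 * (0, - 1))%C
          by (unfold z; apply injective_projections; simpl; ring).
        ring. }
      rewrite Hz.
      replace (RtoC (8 ^ (r - n)) * (0, - 1) ^ (r - n) * z ^ n *
        (RtoC (gbin (INR r - 1 / 4) (r - n) * gbin (INR (r + n)) n) * x ^ n))%C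
      with (RtoC (8 ^ (r - n) * gbin (INR r - 1 / 4) (r - n)) * RtoC (gbin (INR (r + n)) n) *
        (0, - 1) ^ (r - n) * (z ^ n * x ^ n))%C by (rewrite !RtoC_mult; ring).
      rewrite <- Cpow_mult_l.
      repeat apply is_gauss_mult; try apply is_gauss_RtoC; try apply is_gauss_pow.
      + apply is_int_gbin_quarter.
      + apply is_int_gbin.
      + split; [apply (is_int_IZR 0)|apply (is_int_IZR (- 1))].
      + replace (z * x)%C with ((IZR t, IZR 4) : C)
          by (unfold z, x; apply injective_projections; simpl; field).
        split; apply is_int_IZR. }
  (* Real and imaginary parts both solve the recurrence, as its coefficients are real. *)
  exists (fun r => fst (w r)), (fun r => snd (w r)).
  repeat split; try (intros n; apply Hg).
  - intros n; pose proof (f_equal fst (Hw n)) as H; simpl in H; simpl; lra.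
  - intros n; pose proof (f_equal snd (Hw n)) as H; simpl in H; simpl; lra.
  - unfold w; simpl; ring.
  - unfold w; simpl; field.
  - unfold w; simpl; ring.
  - unfold w; simpl; field.
Qed.

(** * Sign of the remainder *)

(* [trig_rem n x] is the integral of [(cos s - cos x)^n cos (s / 4)] for [s] in [0, x];
   only its recurrence and its derivative are needed. *)
Fixpoint trig_rem (n : nat) (x : R) : R :=
  match n with
  | O => 4 * sin (x / 4)
  | S m =>
      match m with
      | O => 16 / 15 * (sin x * cos (x / 4) - 4 * cos x * sin (x / 4))
      | S l =>
          ((INR l + 2) * (INR l + 1) * sin x ^ 2 * trig_rem l x
           - (INR l + 2) * (2 * INR l + 3) * cos x * trig_rem m x)
          / ((INR l + 2) ^ 2 - 1 / 16)
      end
  end.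

Lemma trig_rem_SS (l : nat) (x : R) :
  trig_rem (S (S l)) x =
  ((INR l + 2) * (INR l + 1) * sin x ^ 2 * trig_rem l x
   - (INR l + 2) * (2 * INR l + 3) * cos x * trig_rem (S l) x)
  / ((INR l + 2) ^ 2 - 1 / 16).
Proof. reflexivity. Qed.

Lemma trig_rem_0 (n : nat) : trig_rem n 0 = 0.
Proof.
  assert (H : trig_rem n 0 = 0 /\ trig_rem (S n) 0 = 0).
  { induction n as [|n [IH0 IH1]].
    - unfold trig_rem; rewrite Rdiv_0_l, sin_0; split; ring.
    - split; [exact IH1|]; rewrite trig_rem_SS, IH0, IH1; unfold Rdiv; ring. }
  apply H.
Qed.

(** For the integral this is differentiation under the sign, the boundary term being 0. It is
    derived here from the recurrence, carrying two consecutive cases through the induction. *)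
Lemma trig_rem_derive (n : nat) (x : R) :
  is_derive (trig_rem (S n)) x (INR (S n) * sin x * trig_rem n x).
Proof.
  assert (D1 : forall x, is_derive (trig_rem 1) x (INR 1 * sin x * trig_rem 0 x)).
  { clear; intros x; unfold trig_rem; auto_derive; [exact I|]; unfold INR.
    change (x * / 4) with (x / 4); field. }
  assert (D2 : forall x, is_derive (trig_rem 2) x (INR 2 * sin x * trig_rem 1 x)).
  { intros x'; unfold trig_rem; auto_derive; [exact I|]; simpl INR.
    change (x' * / 4) with (x' / 4); field. }
  assert (H : forall n, (forall x, is_derive (trig_rem (S n)) x (INR (S n) * sin x * trig_rem n x)) /\
    (forall x, is_derive (trig_rem (S (S n))) x (INR (S (S n)) * sin x * trig_rem (S n) x))).
  { clear -D1 D2; induction n as [|n [IH1 IH2]]; [split; assumption|].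
    split; [exact IH2|]; intros x.
    apply (is_derive_ext (fun x => ((INR (S n) + 2) * (INR (S n) + 1) * sin x ^ 2 * trig_rem (S n) x
       - (INR (S n) + 2) * (2 * INR (S n) + 3) * cos x * trig_rem (S (S n)) x)
       / ((INR (S n) + 2) ^ 2 - 1 / 16))); [intros y; symmetry; apply trig_rem_SS|].
    specialize (IH1 x); specialize (IH2 x).
    set (f := trig_rem (S n)) in *; set (g := trig_rem (S (S n))) in *.
    auto_derive.
    { split; [exists (INR (S n) * sin x * trig_rem n x); exact IH1|].
      split; [exists (INR (S (S n)) * sin x * f x); exact IH2|exact I]. }
    change (Derive (fun y => f y) x) with (Derive f x).
    change (Derive (fun y => g y) x) with (Derive g x).
    change (match n with O => 1 | S _ => INR n + 1 end) with (INR (S n)).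
    rewrite (is_derive_unique _ _ _ IH1), (is_derive_unique _ _ _ IH2).
    unfold g, f; rewrite (trig_rem_SS n x), !S_INR.
    pose proof (pos_INR n); field; split; nra. }
  apply H.
Qed.

(** By induction the derivative is positive, and the function vanishes at 0; the mean value theorem
    concludes. *)
Lemma trig_rem_pos (n : nat) (x : R) : 0 < x < PI / 2 -> 0 < trig_rem n x.
Proof.
  revert x; induction n as [|n IH]; intros x Hx.
  - unfold trig_rem; apply Rmult_lt_0_compat; [lra|apply sin_gt_0; lra].
  - destruct (MVT_cor2 (trig_rem (S n)) (fun y => INR (S n) * sin y * trig_rem n y) 0 x)
      as [c [Heq Hc]]; [lra|intros y _; apply is_derive_Reals, trig_rem_derive|].
    rewrite trig_rem_0, !Rminus_0_r in Heq; rewrite Heq.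
    pose proof (lt_0_INR (S n) ltac:(lia)).
    assert (0 < sin c) by (apply sin_gt_0; lra).
    assert (0 < trig_rem n c) by (apply IH; lra).
    repeat apply Rmult_lt_0_compat; lra.
Qed.

(** * Solutions of the recurrence: growth, Casoratian, alternation, decay *)

Lemma thue_rec_lin (t u v : R) (y w : nat -> R) : thue_rec t y -> thue_rec t w ->
  thue_rec t (fun n => u * y n + v * w n).
Proof.
  intros Hy Hw n; specialize (Hy n); specialize (Hw n).
  set (c := 64 * (INR n + 1) - 4 / (INR n + 1)) in *.
  transitivity (u * ((INR n + 2) * y (S (S n))) + v * ((INR n + 2) * w (S (S n))));
    [ring|rewrite Hy, Hw; ring].
Qed.

Lemma thue_rec_coef_bounds (n : nat) :
  64 * INR n <= 64 * (INR n + 1) - 4 / (INR n + 1) <= 64 * (INR n + 1) /\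
  0 < 64 * (INR n + 1) - 4 / (INR n + 1).
Proof.
  pose proof (pos_INR n).
  assert (0 < 4 / (INR n + 1) <= 4); [|lra].
  split; [apply Rdiv_lt_0_compat; lra|].
  apply Rle_div_l; lra.
Qed.

(** Since [2n + 3 <= 2(n + 2)] and the last coefficient is at most [64(n + 2)], the recurrence is
    dominated by the one with constant coefficients [4t] and 64, which [Q ^ n] solves. *)
Lemma thue_rec_upper (t Q : R) (y : nat -> R) :
  0 <= t -> 0 <= Q -> Q ^ 2 = 4 * t * Q + 64 -> thue_rec t y ->
  0 <= y 0%nat <= 1 -> 0 <= y 1%nat <= Q -> forall n, 0 <= y n <= Q ^ n.
Proof.
  intros Ht HQ HQ2 Hy H0 H1 n.
  enough (H : 0 <= y n <= Q ^ n /\ 0 <= y (S n) <= Q ^ S n) by apply H.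
  induction n as [|n [IH0 IH1]]; [simpl; lra|split; [exact IH1|]].
  specialize (Hy n); pose proof (pos_INR n).
  destruct (thue_rec_coef_bounds n) as [[_ Hc] Hc0].
  set (c := 64 * (INR n + 1) - 4 / (INR n + 1)) in *.
  assert (Hl : 0 <= (INR n + 2) * y (S (S n))).
  { rewrite Hy; apply Rplus_le_le_0_compat; repeat apply Rmult_le_pos; lra. }
  assert (Hu : (INR n + 2) * y (S (S n)) <= (INR n + 2) * Q ^ S (S n)).
  { replace (Q ^ S (S n)) with (4 * t * Q ^ S n + 64 * Q ^ n)
      by (simpl in *; transitivity (Q ^ n * (4 * t * Q + 64)); [ring|rewrite <- HQ2; ring]).
    rewrite Hy.
    assert ((2 * INR n + 3) * (2 * t) * y (S n) <= (2 * (INR n + 2)) * (2 * t) * Q ^ S n).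
    { apply Rmult_le_compat; [apply Rmult_le_pos; lra|lra| |lra].
      apply Rmult_le_compat_r; lra. }
    assert (c * y n <= 64 * (INR n + 2) * Q ^ n) by (apply Rmult_le_compat; lra).
    lra. }
  split.
  - apply (Rmult_le_reg_l (INR n + 2)); lra.
  - apply (Rmult_le_reg_l (INR n + 2)); lra.
Qed.

(** The weighted sequence [v n = (n + 1) * y (n + 1)] satisfies
    [v (n + 2) >= 4t * v (n + 1) + 64 * v n], so it dominates [2 * Q ^ n]. *)
Lemma thue_rec_lower (t Q : R) (y : nat -> R) :
  0 <= t -> 0 <= Q <= 6 * t -> Q ^ 2 = 4 * t * Q + 64 -> thue_rec t y ->
  y 0%nat = 0 -> y 1%nat = 2 -> forall n, 2 * Q ^ n <= (INR n + 1) * y (S n).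
Proof.
  intros Ht HQ HQ2 Hy H0 H1 n.
  enough (H : 2 * Q ^ n <= (INR n + 1) * y (S n) /\
    2 * Q ^ S n <= (INR n + 2) * y (S (S n))) by apply H.
  induction n as [|n [IH0 IH1]].
  (* Here [2 * y 2 = 12t], which is where [Q <= 6t] enters. *)
  - rewrite (Hy 0%nat), H0, H1; simpl; lra.
  - rewrite S_INR; split; [lra|].
    replace (INR n + 1 + 2) with (INR (S n) + 2) by (rewrite S_INR; ring).
    rewrite (Hy (S n)).
    destruct (thue_rec_coef_bounds (S n)) as [[Hc _] Hc0].
    set (c := 64 * (INR (S n) + 1) - 4 / (INR (S n) + 1)) in *.
    rewrite S_INR in *; pose proof (pos_INR n).
    assert (P0 : 0 <= y (S n)).
    { apply (Rmult_le_reg_l (INR n + 1)); [lra|].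
      pose proof (pow_le Q n ltac:(lra)); lra. }
    assert (P1 : 0 <= y (S (S n))).
    { apply (Rmult_le_reg_l (INR n + 2)); [lra|].
      pose proof (pow_le Q (S n) ltac:(lra)); lra. }
    replace (Q ^ S (S n)) with (4 * t * Q ^ S n + 64 * Q ^ n)
      by (simpl in *; transitivity (Q ^ n * (4 * t * Q + 64)); [ring|rewrite <- HQ2; ring]).
    assert (64 * (INR n + 1) * y (S n) <= c * y (S n)) by (apply Rmult_le_compat_r; lra).
    assert (4 * t * (2 * Q ^ S n) <= 4 * t * ((INR n + 2) * y (S (S n))))
      by (apply Rmult_le_compat_l; lra).
    assert (0 <= t * y (S (S n))) by (apply Rmult_le_pos; lra).
    lra.
Qed.

Definition casoratian (y w : nat -> R) (n : nat) : R := y n * w (S n) - y (S n) * w n.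

(** The products [y (n + 1) * w (n + 1)] cancel. What is left is a first-order recurrence whose
    factor never vanishes and is at most [64(n + 1)] in absolute value. *)
Lemma casoratian_rec (t : R) (y w : nat -> R) (n : nat) : thue_rec t y -> thue_rec t w ->
  (INR n + 2) * casoratian y w (S n) =
  - (64 * (INR n + 1) - 4 / (INR n + 1)) * casoratian y w n.
Proof.
  intros Hy Hw; unfold casoratian; specialize (Hy n); specialize (Hw n).
  set (c := 64 * (INR n + 1) - 4 / (INR n + 1)) in *.
  transitivity (y (S n) * ((INR n + 2) * w (S (S n))) - (INR n + 2) * y (S (S n)) * w (S n));
    [ring|rewrite Hy, Hw; ring].
Qed.

Lemma casoratian_neq_0 (t : R) (y w : nat -> R) : thue_rec t y -> thue_rec t w ->
  casoratian y w 0 <> 0 -> forall n, casoratian y w n <> 0.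
Proof.
  intros Hy Hw H0; induction n as [|n IH]; [exact H0|]; intros H.
  pose proof (casoratian_rec t y w n Hy Hw) as Hr; rewrite H, Rmult_0_r in Hr.
  destruct (thue_rec_coef_bounds n) as [_ Hc].
  symmetry in Hr; apply Rmult_integral in Hr; destruct Hr; [lra|contradiction].
Qed.

Lemma casoratian_bound (t : R) (y w : nat -> R) : thue_rec t y -> thue_rec t w ->
  forall n, (INR n + 1) * Rabs (casoratian y w n) <= Rabs (casoratian y w 0) * 64 ^ n.
Proof.
  intros Hy Hw; induction n as [|n IH]; [simpl; lra|].
  pose proof (f_equal Rabs (casoratian_rec t y w n Hy Hw)) as Hr.
  destruct (thue_rec_coef_bounds n) as [[_ Hc] Hc0]; pose proof (pos_INR n).
  set (c := 64 * (INR n + 1) - 4 / (INR n + 1)) in *.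
  rewrite !Rabs_mult, Rabs_Ropp, (Rabs_pos_eq (INR n + 2)), (Rabs_pos_eq c) in Hr by lra.
  rewrite S_INR; replace (INR n + 1 + 1) with (INR n + 2) by ring; rewrite Hr.
  pose proof (Rabs_pos (casoratian y w n)).
  assert (c * Rabs (casoratian y w n) <= 64 * (INR n + 1) * Rabs (casoratian y w n))
    by (apply Rmult_le_compat_r; lra).
  simpl; lra.
Qed.

(* [t = 4 cot x] and [y 1 = 2 (cot (x / 4) - t)]: the solution of the recurrence
   starting from these values is the minimal one, a signed multiple of [trig_rem]. *)
Lemma thue_rec_alternating (t x : R) (y : nat -> R) :
  0 < x < PI / 2 -> 4 * cos x = t * sin x -> thue_rec t y ->
  y 0%nat = -1 -> y 1%nat * sin (x / 4) = 2 * (cos (x / 4) - t * sin (x / 4)) ->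
  forall n, 0 < (-1) ^ S n * y n.
Proof.
  intros Hx Ht Hy H0 H1.
  assert (Hs : 0 < sin x) by (apply sin_gt_0; lra).
  assert (Hs4 : 0 < sin (x / 4)) by (apply sin_gt_0; lra).
  (* Prescribing the ratio of two consecutive multipliers makes the recurrence of [trig_rem] match
     that of [y]; the ratio is positive, so the sign of [y n] is known. *)
  assert (H : forall n, exists g, 0 < g /\ y n = (-1) ^ S n * g * trig_rem n x /\
    y (S n) = (-1) ^ n * (g * (16 * (INR n + 1) ^ 2 - 1) /
      (2 * sin x * (INR n + 1) ^ 2)) * trig_rem (S n) x).
  { induction n as [|n [g [Hg [IH0 IH1]]]].
    - exists (/ (4 * sin (x / 4))); split; [apply Rinv_0_lt_compat; lra|split].
      + rewrite H0; unfold trig_rem; simpl; field; lra.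
      + apply (Rmult_eq_reg_r (sin (x / 4))); [|lra].
        rewrite H1; unfold trig_rem; simpl.
        replace (4 * cos x * sin (x / 4)) with (t * sin x * sin (x / 4)) by (rewrite Ht; ring).
        field; lra.
    - pose proof (pos_INR n).
      exists (g * (16 * (INR n + 1) ^ 2 - 1) / (2 * sin x * (INR n + 1) ^ 2)).
      split; [apply Rdiv_lt_0_compat; [apply Rmult_lt_0_compat|apply Rmult_lt_0_compat]; nra|].
      split; [rewrite IH1; simpl; ring|].
      apply (Rmult_eq_reg_l (INR n + 2)); [|lra].
      rewrite (Hy n), IH0, IH1, trig_rem_SS, S_INR.
      replace (cos x) with (t * sin x / 4) by lra.
      simpl pow; field; repeat split; nra. }
  intros n; destruct (H n) as [g [Hg [-> _]]].
  pose proof (trig_rem_pos n x Hx).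
  replace ((-1) ^ S n * ((-1) ^ S n * g * trig_rem n x))
    with (((-1) ^ S n * (-1) ^ S n) * (g * trig_rem n x)) by ring.
  rewrite <- Rpow_mult_distr; replace (-1 * -1) with 1 by ring; rewrite pow1.
  rewrite Rmult_1_l; apply Rmult_lt_0_compat; assumption.
Qed.

(** With [t / 4 = cot x], the formula [2 cot (2u) = cot u - 1 / cot u] applied twice identifies [e]
    with [cot (x / 2)] and [b] with [cot (x / 4)], each as the positive root of its quadratic. *)
Lemma cot_quarter_angle (t e b : R) :
  0 < t -> 0 < e -> 2 * e ^ 2 = t * e + 2 -> 0 < b -> b ^ 2 = 2 * e * b + 1 ->
  exists x, 0 < x < PI / 2 /\ 4 * cos x = t * sin x /\ cos (x / 4) = b * sin (x / 4).
Proof.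
  intros Ht He He2 Hb Hb2.
  set (x := atan (4 / t)).
  assert (Hx : 0 < x < PI / 2).
  { split; [rewrite <- atan_0; apply atan_increasing, Rdiv_lt_0_compat; lra|].
    apply atan_bound. }
  assert (Hc : 0 < cos x) by (apply cos_gt_0; lra).
  assert (Htan : 4 * cos x = t * sin x).
  { pose proof (tan_atan (4 / t)) as H; fold x in H; unfold tan in H.
    replace (sin x) with (sin x / cos x * cos x) by (field; lra).
    rewrite H; field; lra. }
  exists x; split; [exact Hx|split; [exact Htan|]].
  assert (Hs2 : 0 < sin (x / 2)) by (apply sin_gt_0; lra).
  assert (Hc2 : 0 < cos (x / 2)) by (apply cos_gt_0; lra).
  assert (Hs4 : 0 < sin (x / 4)) by (apply sin_gt_0; lra).
  assert (Hc4 : 0 < cos (x / 4)) by (apply cos_gt_0; lra).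
  assert (E2 : cos (x / 2) = e * sin (x / 2)).
  { replace x with (2 * (x / 2)) in Htan by field.
    rewrite cos_2a, sin_2a in Htan.
    set (c := cos (x / 2)) in *; set (s := sin (x / 2)) in *.
    assert (F : (c - e * s) * (c + s / e) = 0).
    { replace ((c - e * s) * (c + s / e)) with (c * c - (e - 1 / e) * (s * c) - s * s)
        by (field; lra).
      replace (e - 1 / e) with (t / 2) by (apply (Rmult_eq_reg_r e); [field_simplify; lra|lra]).
      lra. }
    apply Rmult_integral in F; destruct F as [F|F]; [lra|].
    assert (0 < s / e) by (apply Rdiv_lt_0_compat; lra); lra. }
  replace (x / 2) with (2 * (x / 4)) in E2 by field.
  rewrite cos_2a, sin_2a in E2.
  set (c := cos (x / 4)) in *; set (s := sin (x / 4)) in *.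
  assert (F : (c - b * s) * (c + s / b) = 0).
  { replace ((c - b * s) * (c + s / b)) with (c * c - (b - 1 / b) * (s * c) - s * s)
      by (field; lra).
    replace (b - 1 / b) with (2 * e) by (apply (Rmult_eq_reg_r b); [field_simplify; lra|lra]).
    lra. }
  apply Rmult_integral in F; destruct F as [F|F]; [lra|].
  assert (0 < s / b) by (apply Rdiv_lt_0_compat; lra); lra.
Qed.

(* The lower bound on the denominators turns the Casoratian bound into the exact
   decay rate of the remainder, because consecutive remainders have opposite signs. *)
Lemma thue_rec_remainder (t Q b : R) (y w : nat -> R) :
  0 <= t -> 0 < Q <= 6 * t -> Q ^ 2 = 4 * t * Q + 64 ->
  thue_rec t y -> thue_rec t w -> y 0%nat = -1 -> w 0%nat = 0 -> w 1%nat = 2 ->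
  (forall n, 0 < (-1) ^ S n * y n) -> (forall n, 0 <= w n) ->
  forall n, Rabs (y n) * Q ^ n <= 64 ^ n.
Proof.
  intros Ht HQ HQ2 Hy Hw y0 w0 w1 Hs Hw0 n.
  pose proof (thue_rec_lower t Q w Ht ltac:(lra) HQ2 Hw w0 w1 n) as Hl.
  pose proof (casoratian_bound t y w Hy Hw n) as Hb.
  assert (K0 : Rabs (casoratian y w 0) = 2).
  { unfold casoratian; rewrite y0, w0, w1.
    replace (-1 * 2 - y 1%nat * 0) with (- (2)) by ring; rewrite Rabs_Ropp; apply Rabs_pos_eq; lra. }
  rewrite K0 in Hb.
  assert (Hk : Rabs (y n) * w (S n) <= Rabs (casoratian y w n)).
  { pose proof (Hs n) as H0; pose proof (Hs (S n)) as H1.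
    assert (Ha : Rabs (y n) = (-1) ^ S n * y n).
    { rewrite <- (Rabs_pos_eq ((-1) ^ S n * y n)) by lra.
      rewrite Rabs_mult, pow_1_abs; ring. }
    rewrite Ha; unfold casoratian.
    transitivity ((-1) ^ S n * (y n * w (S n) - y (S n) * w n)).
    - pose proof (Rmult_le_pos _ _ (Rlt_le _ _ H1) (Hw0 n)).
      simpl in *; lra.
    - apply Rle_trans with (1 := Rle_abs _).
      rewrite Rabs_mult, pow_1_abs; lra. }
  pose proof (pos_INR n); pose proof (Rabs_pos (y n)).
  assert (Rabs (y n) * (2 * Q ^ n) <= Rabs (y n) * ((INR n + 1) * w (S n)))
    by (apply Rmult_le_compat_l; lra).
  assert ((INR n + 1) * (Rabs (y n) * w (S n)) <= (INR n + 1) * Rabs (casoratian y w n))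
    by (apply Rmult_le_compat_l; lra).
  lra.
Qed.

(** * From approximants to an irrationality measure *)

Lemma irrationality_measure (beta E Q l kappa p q : R) (A B : nat -> R) :
  1 < E -> 1 <= Q -> 0 <= kappa -> Rpower E kappa = Q ->
  is_int p -> is_int q -> (forall n, is_int (A n)) -> (forall n, is_int (B n)) ->
  (forall n, Rabs (B n) <= Q ^ n) -> (forall n, Rabs (B n * beta - A n) * E ^ n <= l) ->
  (forall n, casoratian A B n <> 0) -> 1 <= 2 * l * Rabs q ->
  1 / (2 * Q * Rpower (2 * l * E * Rabs q) kappa) < Rabs (p - beta * q).
Proof.
  intros HE HQ Hk HEQ Hp Hq HA HB HBQ Hl Hdet Hlq.
  (* From index [r + 1] on, the remainder multiplied by [q] is below 1/2. *)
  assert (Hex : exists r, E ^ r <= 2 * l * Rabs q < E ^ S r).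
  { destruct (Pow_x_infinity E ltac:(rewrite Rabs_pos_eq; lra) (2 * l * Rabs q + 1)) as [N HN].
    specialize (HN N (le_n N)).
    rewrite Rabs_pos_eq in HN by (apply pow_le; lra).
    assert (H : 2 * l * Rabs q < E ^ N) by lra; clear HN.
    induction N as [|N IH]; [simpl in H; lra|].
    destruct (Rle_lt_dec (E ^ N) (2 * l * Rabs q)) as [H'|H']; [now exists N|now apply IH]. }
  destruct Hex as [r [Hr1 Hr2]].
  set (d := Rabs (p - beta * q)).
  (* A nonzero integer [p * B n - q * A n] has modulus at least 1, of which the remainder accounts
     for less than half. *)
  assert (Hstep : forall n, (S r <= n <= S (S r))%nat -> p * B n - q * A n <> 0 ->
    1 < 2 * Q ^ S (S r) * d).
  { intros n Hn Hne.
    assert (Hone : 1 <= Rabs (p * B n - q * A n)).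
    { destruct (is_int_minus _ _ (is_int_mult _ _ Hp (HB n)) (is_int_mult _ _ Hq (HA n)))
        as [z Hz]; rewrite Hz in *.
      rewrite <- abs_IZR; apply IZR_le.
      assert (z <> 0%Z) by (intros ->; apply Hne; reflexivity); lia. }
    assert (Htri : Rabs (p * B n - q * A n) <=
      Rabs (B n) * d + Rabs q * Rabs (B n * beta - A n)).
    { unfold d; rewrite <- !Rabs_mult.
      replace (p * B n - q * A n) with (B n * (p - beta * q) + q * (B n * beta - A n)) by ring.
      apply Rabs_triang. }
    assert (HEn : E ^ S r <= E ^ n) by (apply Rle_pow; [lra|lia]).
    assert (HQn : Q ^ n <= Q ^ S (S r)) by (apply Rle_pow; [lra|lia]).
    assert (Hd : 0 <= d) by apply Rabs_pos.
    assert (Rabs (B n) * d <= Q ^ S (S r) * d).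
    { apply Rmult_le_compat_r; [lra|]; specialize (HBQ n); lra. }
    assert (2 * (Rabs q * Rabs (B n * beta - A n)) < 1); [|lra].
    assert (0 < E ^ n) by (apply pow_lt; lra).
    apply (Rmult_lt_reg_r (E ^ n)); [lra|].
    pose proof (Rmult_le_compat_l (2 * Rabs q) _ _ ltac:(pose proof (Rabs_pos q); lra) (Hl n)).
    lra. }
  (* The nonzero Casoratian keeps the integers at [r + 1] and [r + 2] from both vanishing. *)
  assert (Hd : 1 < 2 * Q ^ S (S r) * d).
  { destruct (Req_dec (p * B (S r) - q * A (S r)) 0) as [H1|H1];
      [|apply (Hstep (S r)); [lia|exact H1]].
    destruct (Req_dec (p * B (S (S r)) - q * A (S (S r))) 0) as [H2|H2];
      [|apply (Hstep (S (S r))); [lia|exact H2]].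
    exfalso; specialize (Hdet (S r)); unfold casoratian in Hdet.
    assert (q <> 0).
    { intros ->; rewrite Rabs_R0 in Hlq; lra. }
    apply Hdet; apply (Rmult_eq_reg_l q); [|assumption].
    transitivity ((q * A (S r)) * B (S (S r)) - (q * A (S (S r))) * B (S r)); [ring|].
    replace (q * A (S r)) with (p * B (S r)) by lra.
    replace (q * A (S (S r))) with (p * B (S (S r))) by lra.
    ring. }
  assert (HQr : Q ^ S r <= Rpower (2 * l * E * Rabs q) kappa).
  { assert (0 < E ^ S r) by (apply pow_lt; lra).
    replace (Q ^ S r) with (Rpower (E ^ S r) kappa).
    - apply Rle_Rpower_l; [exact Hk|split; [assumption|]].
      pose proof (Rmult_le_compat_l E _ _ ltac:(lra) Hr1); simpl; lra.
    - rewrite <- HEQ, <- (Rpower_pow (S r) E), <- (Rpower_pow (S r) (Rpower E kappa)),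
        !Rpower_mult by (try apply exp_pos; lra).
      f_equal; ring. }
  set (P := Rpower (2 * l * E * Rabs q) kappa) in *.
  assert (0 < P) by apply exp_pos.
  assert (0 <= d) by apply Rabs_pos.
  apply Rlt_div_l; [apply Rmult_lt_0_compat; lra|].
  apply Rlt_le_trans with (1 := Hd).
  simpl pow in Hd |- *; simpl pow in HQr.
  rewrite (Rmult_comm d); apply Rmult_le_compat_r; [lra|].
  replace (2 * (Q * (Q * Q ^ r))) with (2 * Q * (Q * Q ^ r)) by ring.
  apply Rmult_le_compat_l; lra.
Qed.

(** * Application to the roots *)

Lemma eps_t_eq (t : Z) : 2 * eps_t t ^ 2 = IZR t * eps_t t + 2.
Proof.
  unfold eps_t; assert (H : 0 <= IZR t ^ 2 + 16) by nra.
  pose proof (sqrt_sqrt _ H); nra.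
Qed.

Lemma eps_t_bounds (t : Z) : (128 <= t)%Z ->
  IZR t < 2 * eps_t t /\ eps_t t <= IZR t / 2 + 1 / 64.
Proof.
  intros Ht; apply IZR_le in Ht; unfold eps_t.
  assert (H : 0 <= IZR t ^ 2 + 16) by nra.
  assert (H1 : IZR t < sqrt (IZR t ^ 2 + 16)).
  { rewrite <- (sqrt_pow2 (IZR t)) at 1 by lra; apply sqrt_lt_1; nra. }
  (* The square of [t + 1/16] exceeds [t^2 + t/8], and [t/8 >= 16]. *)
  assert (H2 : sqrt (IZR t ^ 2 + 16) <= IZR t + 1 / 16).
  { rewrite <- (sqrt_pow2 (IZR t + 1 / 16)) by lra; apply sqrt_le_1; nra. }
  lra.
Qed.

Lemma beta_2_eq (t : Z) : beta_t t 2 ^ 2 = 2 * eps_t t * beta_t t 2 + 1.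
Proof.
  unfold beta_t, rho_t.
  pose proof (sqrt_sqrt (1 + eps_t t ^ 2) ltac:(nra)); nra.
Qed.

Lemma thue_approximations (t : Z) : (128 <= t)%Z -> exists a b : nat -> R,
  (forall n, is_int (a n)) /\ (forall n, is_int (b n)) /\
  (forall n, 0 <= a n) /\ (forall n, 0 <= b n) /\
  (forall n, a n + b n <= (8 * eps_t t) ^ n) /\
  (forall n, Rabs (b n * beta_t t 2 - a n) * (eps_t t / 8) ^ n <= 1) /\
  (forall n, casoratian a b n <> 0).
Proof.
  intros Ht; pose proof (eps_t_bounds t Ht) as He; pose proof (eps_t_eq t) as He2.
  pose proof (beta_2_eq t) as Hb2.
  assert (Hb : 0 < beta_t t 2).
  { unfold beta_t, rho_t; pose proof (sqrt_pos (1 + eps_t t ^ 2)).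
    apply IZR_le in Ht; lra. }
  destruct (thue_rec_int_solutions t) as (a & b & Ha & Hb' & a0 & a1 & b0 & b1 & Hai & Hbi).
  apply IZR_le in Ht.
  set (e := eps_t t) in *; set (be := beta_t t 2) in *.
  assert (HQ2 : (8 * e) ^ 2 = 4 * IZR t * (8 * e) + 64) by nra.
  assert (Hap : forall n, 0 <= a n <= (8 * e) ^ n)
    by (apply (thue_rec_upper (IZR t)); try assumption; lra).
  assert (Hbp : forall n, 0 <= b n <= (8 * e) ^ n)
    by (apply (thue_rec_upper (IZR t)); try assumption; lra).
  (* The sum is itself a solution, starting from 1 and [2t + 2 <= 8 * e]; it bounds the denominators
     [a + b] and [a - b] used for other roots. *)
  assert (Habp : forall n, 0 <= 1 * a n + 1 * b n <= (8 * e) ^ n).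
  { apply (thue_rec_upper (IZR t)); try lra; now apply thue_rec_lin. }
  exists a, b; repeat split; try assumption.
  - intros n; apply Hap.
  - intros n; apply Hbp.
  - intros n; specialize (Habp n); lra.
  - destruct (cot_quarter_angle (IZR t) e be) as [x [Hx [Hx1 Hx4]]]; try lra.
    set (y := fun n => be * b n + (-1) * a n).
    assert (Hy : thue_rec (IZR t) y) by now apply thue_rec_lin.
    intros n.
    assert (H : Rabs (y n) * (8 * e) ^ n <= 64 ^ n).
    { apply (thue_rec_remainder (IZR t) (8 * e) be y b); try assumption; try lra.
      - unfold y; rewrite a0, b0; ring.
      - apply (thue_rec_alternating (IZR t) x); try assumption.
        + unfold y; rewrite a0, b0; ring.
        + unfold y; rewrite a1, b1, Hx4; ring.
      - intros m; apply Hbp. }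
    unfold y in H; replace (be * b n + -1 * a n) with (b n * be - a n) in H by ring.
    apply (Rmult_le_reg_r (64 ^ n)); [apply pow_lt; lra|].
    rewrite Rmult_1_l, Rmult_assoc, <- Rpow_mult_distr.
    replace (e / 8 * 64) with (8 * e) by field; exact H.
  - apply (casoratian_neq_0 (IZR t)); try assumption.
    unfold casoratian; rewrite a0, a1, b0, b1; lra.
Qed.

Lemma kappa_t_pow (t : Z) : (128 <= t)%Z ->
  0 <= kappa_t t /\ Rpower (eps_t t / 8) (kappa_t t) = 8 * eps_t t.
Proof.
  intros Ht; pose proof (eps_t_bounds t Ht) as He; apply IZR_le in Ht.
  assert (H0 : 0 < ln (eps_t t / 8)) by (rewrite <- ln_1; apply ln_increasing; lra).
  assert (H1 : 0 < ln (8 * eps_t t)) by (rewrite <- ln_1; apply ln_increasing; lra).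
  unfold kappa_t; split; [apply Rlt_le, Rdiv_lt_0_compat; assumption|].
  unfold Rpower; replace (ln (8 * eps_t t) / ln (eps_t t / 8) * ln (eps_t t / 8))
    with (ln (8 * eps_t t)) by (field; lra).
  apply exp_ln; lra.
Qed.

Lemma beta_2_gt (t : Z) : (128 <= t)%Z -> IZR t < beta_t t 2.
Proof.
  intros Ht; pose proof (eps_t_bounds t Ht) as He; apply IZR_le in Ht.
  unfold beta_t, rho_t.
  enough (eps_t t <= sqrt (1 + eps_t t ^ 2)) by lra.
  rewrite <- (sqrt_pow2 (eps_t t)) at 1 by lra; apply sqrt_le_1; nra.
Qed.

(** If [beta_2 = cot u], then [beta_0], [beta_1], [beta_3] are the cotangents of [u + PI/2],
    [u + PI/4], [u - PI/4]. *)
Lemma beta_t_from_2 (t : Z) : (128 <= t)%Z ->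
  beta_t t 0 * beta_t t 2 = -1 /\
  beta_t t 1 * (beta_t t 2 + 1) = beta_t t 2 - 1 /\
  beta_t t 3 * (beta_t t 2 - 1) = - (beta_t t 2 + 1).
Proof.
  intros Ht; pose proof (eps_t_bounds t Ht) as He; apply IZR_le in Ht.
  unfold beta_t, rho_t; pose proof (sqrt_sqrt (1 + eps_t t ^ 2) ltac:(nra)) as Hs.
  set (s := sqrt _) in *; set (e := eps_t t) in *.
  repeat split.
  - nra.
  - apply (Rmult_eq_reg_r e); [field_simplify; nra|lra].
  - apply (Rmult_eq_reg_r e); [field_simplify; nra|lra].
Qed.

(** Take [E = eps / 8] and [Q = 8 eps]: then [2 Q = 16 eps <= 8t + 1/4 <= 8.01 t], and
    [2 l E = l eps / 4 <= k]. *)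
Lemma approximation_bound (t : Z) (j : nat) (l c k : R) (A B : nat -> R) (p q : Z) :
  (128 <= t)%Z ->
  (forall n, is_int (A n)) -> (forall n, is_int (B n)) ->
  (forall n, Rabs (B n) <= (8 * eps_t t) ^ n) ->
  (forall n, Rabs (B n * beta_t t j - A n) * (eps_t t / 8) ^ n <= l) ->
  (forall n, casoratian A B n <> 0) ->
  1 <= 2 * l * Rabs (IZR q) -> 0 < l -> l * eps_t t <= 4 * k -> 801 / 100 <= c ->
  Rabs (IZR p - beta_t t j * IZR q) >
    1 / (c * IZR t * Rpower k (kappa_t t) * Rpower (Rabs (IZR q)) (kappa_t t)).
Proof.
  intros Ht HA HB HBQ Hl Hdet Hlq Hl0 Hk Hc.
  pose proof (eps_t_bounds t Ht) as He.
  destruct (kappa_t_pow t Ht) as [Hk0 HkE].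
  assert (Ht' := IZR_le _ _ Ht).
  assert (Hq : 0 < Rabs (IZR q)).
  { pose proof (Rabs_pos (IZR q)); nra. }
  pose proof (irrationality_measure (beta_t t j) (eps_t t / 8) (8 * eps_t t) l (kappa_t t)
    (IZR p) (IZR q) A B ltac:(lra) ltac:(lra) Hk0 HkE (is_int_IZR p) (is_int_IZR q)
    HA HB HBQ Hl Hdet Hlq) as H.
  apply Rlt_gt, Rle_lt_trans with (2 := H).
  assert (0 < l * eps_t t) by (apply Rmult_lt_0_compat; lra).
  rewrite Rmult_assoc, Rpower_mult_distr by lra.
  apply Rmult_le_compat_l; [lra|]; apply Rinv_le_contravar.
  - apply Rmult_lt_0_compat; [lra|apply exp_pos].
  - apply Rmult_le_compat; [lra|left; apply exp_pos| |].
    { assert (801 / 100 * IZR t <= c * IZR t) by (apply Rmult_le_compat_r; lra); lra. }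
    apply Rle_Rpower_l; [exact Hk0|].
    replace (2 * l * (eps_t t / 8) * Rabs (IZR q)) with (l * eps_t t / 4 * Rabs (IZR q)) by field.
    split; [apply Rmult_lt_0_compat; lra|apply Rmult_le_compat_r; lra].
Qed.

Theorem theorem3p1 (t : Z) (ht : (128 <= t)%Z) (j : nat) (hj : (j <= 3)%nat)
  (p q : Z) (hq : Rabs (IZR q) > (16/100) * IZR t) :
  Rabs (IZR p - beta_t t j * IZR q) >
    1 / (c_t t j * Rpower (Rabs (IZR q)) (kappa_t t)).
Proof.
  destruct (thue_approximations t ht) as (a & b & Ha & Hb & Ha0 & Hb0 & Hab & Hrem & Hdet).
  pose proof (eps_t_bounds t ht) as He.
  pose proof (beta_2_gt t ht) as Hbe.
  destruct (beta_t_from_2 t ht) as (E0 & E1 & E3).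
  assert (Ht := IZR_le _ _ ht).
  set (be := beta_t t 2) in *.
  (* The value [l = 25 / (8t)] is the one for which [2 * l * 0.16 t = 1]. *)
  assert (Hl : 25 / 8 / IZR t * eps_t t <= 4 * (4 / 10)).
  { replace (25 / 8 / IZR t * eps_t t) with (25 / 8 * eps_t t / IZR t) by (field; lra).
    apply Rle_div_l; lra. }
  assert (Hl0 : 0 < 25 / 8 / IZR t) by (apply Rdiv_lt_0_compat; lra).
  assert (Hlq : 1 <= 2 * (25 / 8 / IZR t) * Rabs (IZR q)).
  { replace (2 * (25 / 8 / IZR t) * Rabs (IZR q))
      with (25 / 4 * Rabs (IZR q) / IZR t) by (field; lra).
    apply Rle_div_r; lra. }
  (* [r] is the factor by which a linear change of approximants scales the remainder. *)
  assert (Hscale : forall r, Rabs r * (IZR t - 1) <= 2 -> forall n,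
    Rabs (r * (b n * be - a n)) * (eps_t t / 8) ^ n <= 25 / 8 / IZR t).
  { intros r Hr n; rewrite Rabs_mult, Rmult_assoc.
    apply Rle_trans with (Rabs r * 1).
    - apply Rmult_le_compat_l; [apply Rabs_pos|apply Hrem].
    - rewrite Rmult_1_r; apply Rle_div_r; [lra|].
      pose proof (Rmult_le_compat_l _ 127 (IZR t - 1) (Rabs_pos r) ltac:(lra)); lra. }
  destruct j as [|[|[|[|j]]]]; [| | | |lia].
  - apply (approximation_bound t 0 (25 / 8 / IZR t) (1133 / 100) (4 / 10) (fun n => - b n) a);
      try assumption; try lra.
    + intros n; replace (- b n) with (0 - b n) by ring.
      apply is_int_minus; [apply (is_int_IZR 0)|apply Hb].
    + intros n; rewrite Rabs_pos_eq by apply Ha0; specialize (Hab n); specialize (Hb0 n); lra.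
    + intros n; replace (a n * beta_t t 0 - - b n) with (/ be * (b n * be - a n)).
      * apply Hscale; rewrite Rabs_pos_eq by (left; apply Rinv_0_lt_compat; lra).
        rewrite Rmult_comm; apply Rle_div_l; lra.
      * replace (beta_t t 0) with (- / be); [field; lra|].
        apply (Rmult_eq_reg_r be); [rewrite E0; field; lra|lra].
    + intros n Hn; apply (Hdet n); unfold casoratian in *; lra.
  - apply (approximation_bound t 1 (25 / 8 / IZR t) (1133 / 100) (4 / 10)
      (fun n => a n - b n) (fun n => a n + b n)); try assumption; try lra.
    + intros n; now apply is_int_minus.
    + intros n; now apply is_int_plus.
    + intros n; specialize (Ha0 n); specialize (Hb0 n); rewrite Rabs_pos_eq by lra; apply Hab.
    + intros n; replace ((a n + b n) * beta_t t 1 - (a n - b n))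
        with (2 / (be + 1) * (b n * be - a n)).
      * apply Hscale; rewrite Rabs_pos_eq by (left; apply Rdiv_lt_0_compat; lra).
        replace (2 / (be + 1) * (IZR t - 1)) with (2 * (IZR t - 1) / (be + 1)) by (field; lra).
        apply Rle_div_l; lra.
      * replace (beta_t t 1) with ((be - 1) / (be + 1)); [field; lra|].
        apply (Rmult_eq_reg_r (be + 1)); [rewrite E1; field; lra|lra].
    + intros n Hn; apply (Hdet n); unfold casoratian in *; lra.
  (* For [beta_2] the approximants are used unchanged, with [l = 1]. *)
  - apply (approximation_bound t 2 1 (801 / 100) (4 / 10 * IZR t) a b); try assumption; try lra.
    intros n; rewrite Rabs_pos_eq by apply Hb0; specialize (Hab n); specialize (Ha0 n); lra.
  - apply (approximation_bound t 3 (25 / 8 / IZR t) (1133 / 100) (4 / 10)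
      (fun n => - (a n + b n)) (fun n => a n - b n)); try assumption; try lra.
    + intros n; replace (- (a n + b n)) with (0 - (a n + b n)) by ring.
      apply is_int_minus; [apply (is_int_IZR 0)|now apply is_int_plus].
    + intros n; now apply is_int_minus.
    + intros n; specialize (Ha0 n); specialize (Hb0 n); specialize (Hab n).
      apply Rabs_le; lra.
    (* The largest scaling factor occurs here: [be - 1 > t - 1] is the reason for [t - 1] in
       [Hscale]. *)
    + intros n; replace ((a n - b n) * beta_t t 3 - - (a n + b n))
        with (2 / (be - 1) * (b n * be - a n)).
      * apply Hscale; rewrite Rabs_pos_eq by (left; apply Rdiv_lt_0_compat; lra).
        replace (2 / (be - 1) * (IZR t - 1)) with (2 * (IZR t - 1) / (be - 1)) by (field; lra).
        apply Rle_div_l; lra.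
      * replace (beta_t t 3) with (- (be + 1) / (be - 1)); [field; lra|].
        apply (Rmult_eq_reg_r (be - 1)); [rewrite E3; field; lra|lra].
    + intros n Hn; apply (Hdet n); unfold casoratian in *; lra.
Qed.
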